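(* Let $(\lambda_n)$ be a sequence of positive reals with $\lambda_n\to\infty$ (arbitrarily slowly). Then $\mathcal{G}\big(n,p=2(1+\lambda_n n^{-1/5})/n,2\big)$ is w.h.p. not adaptably $2$-colorable.
   Context: For a finite simple graph $G=(V,E)$ with a (not necessarily proper) edge coloring $c:E\to\{red,blue\}$, a vertex coloring $\sigma:V\to\{red,blue\}$ is adapted to $c$ if for every edge $uv\in E$ either $\sigma(u)\neq c(uv)$ or $\sigma(v)\ne c(uv)$. The pair $(G,c)$ is adaptably $2$-colorable if there exists a vertex coloring adapted to $c$. $\mathcal{G}(n,p,2)$ is the random pair $(G,c)$ in which each possible edge on $n$ labelled vertices is included independently with probability $p$ (it is understood that $p\in[0,1]$), and each included edge is independently assigned a uniformly random color from $\{red,blue\}$. A sequence of events $A_n$ occurs w.h.p. if $\mathbb{P}[A_n]\to 1$ as $n\to\infty$. ''Arbitrarily slowly'' means that no lower bound on the growth rate of $\lambda_n$ is imposed. *)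

(* Defs.v *)
From HB Require Import structures.
From mathcomp Require Import all_boot all_order all_algebra.
From mathcomp Require Import all_classical all_reals all_analysis.

Set Implicit Arguments.
Unset Strict Implicit.
Unset Printing Implicit Defensive.

Import Order.TTheory GRing.Theory Num.Theory.

Local Open Scope ring_scope.

Variant color := red | blue.

Definition bool_of_color (a : color) : bool := if a is red then true else false.
Definition color_of_bool (b : bool) : color := if b then red else blue.
Lemma bool_of_colorK : cancel bool_of_color color_of_bool.
Proof. by case. Qed.

HB.instance Definition _ := Finite.copy color (can_type bool_of_colorK).

Lemma card_color : #|{: color}| = 2%N.
Proof.
rewrite -card_bool; apply: (@bij_eq_card _ _ bool_of_color).
by exists color_of_bool => // -[].
Qed.

Definition vpair (V : finType) := {e : {set V} | #|e| == 2%N}.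

(* A pair (G, c): [Gc e = None] when the pair e is not an edge of G, and
   [Gc e = Some a] when e is an edge of G with c(e) = a. *)
Definition colored_graph (V : finType) := {ffun vpair V -> option color}.

Definition adapted (V : finType) (Gc : colored_graph V)
    (sigma : {ffun V -> color}) : bool :=
  [forall e : vpair V, forall u : V, forall v : V, forall a : color,
    (val e == [set u; v]) && (Gc e == Some a) ==>
      (sigma u != a) || (sigma v != a)].

Definition adaptably_2_colorable (V : finType) (Gc : colored_graph V) : bool :=
  [exists sigma : {ffun V -> color}, adapted Gc sigma].

(* The law of G(n,p,2): the states of the pairs are independent, and each pair
   is an edge with probability p, its color then being uniform. *)
Definition pair_mass (R : realType) (p : R) (s : option color) : R :=
  if s is Some _ then p * (#|{: color}|%:R)^-1 else 1 - p.

Definition gnp2_mass (R : realType) (n : nat) (p : R)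
    (Gc : colored_graph 'I_n) : R :=
  \prod_(e : vpair 'I_n) pair_mass p (Gc e).

Definition gnp2_prob (R : realType) (n : nat) (p : R)
    (A : pred (colored_graph 'I_n)) : R :=
  \sum_(Gc : colored_graph 'I_n | A Gc) gnp2_mass p Gc.

Lemma pair_mass_ge0 (R : realType) (p : R) (s : option color) :
  0 <= p <= 1 -> 0 <= pair_mass p s.
Proof.
case/andP=> p0 p1; case: s => [a|] /=; last by rewrite subr_ge0.
by rewrite mulr_ge0 // invr_ge0.
Qed.

Lemma gnp2_mass_ge0 (R : realType) (n : nat) (p : R) (Gc : colored_graph 'I_n) :
  0 <= p <= 1 -> 0 <= gnp2_mass p Gc.
Proof. by move=> p01; apply: prodr_ge0 => e _; exact: pair_mass_ge0. Qed.

Lemma pair_mass_sum1 (R : realType) (p : R) :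
  \sum_(s : option color) pair_mass p s = 1.
Proof.
rewrite (bigD1 None) //= (reindex_omap (@Some color) id) /=; last by case.
under eq_bigl => a do rewrite eqxx.
rewrite sumr_const card_color -mulrnAr -[_^-1 *+ 2]mulr_natr.
by rewrite mulVf ?mulr1 ?subrK // pnatr_eq0.
Qed.

Lemma gnp2_prob_total (R : realType) (n : nat) (p : R) :
  gnp2_prob p (@predT (colored_graph 'I_n)) = 1.
Proof.
rewrite /gnp2_prob /gnp2_mass.
rewrite -(bigA_distr_bigA (fun (_ : vpair 'I_n) s => pair_mass p s)).
by apply: big1 => e _; exact: pair_mass_sum1.
Qed.

(* Main.v *)
(* Second moment method. Colors are forced along alternating walks, so no
   adapted coloring exists once (G, c) contains a snake: two odd cycles of length
   t sharing one vertex, the center, alternating in color except that at the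
   center one cycle has two edges of one color and the other cycle two edges of
   the other color. With q = p/2 and rho = q n = 1 + eps, the expected number of
   snakes is about rho^(2t)/n, which is huge when eps t is much larger than ln n.
   Conditionally on a snake A, the expected number of snakes is at most a sum over
   closed walks whose steps have weight q, plus 1 for the steps of A. A step of
   weight q forgets the current vertex, while an alternating walk inside A is
   determined by its start except at the center. Only snakes with the same center
   as A can have four arms inside A, with at most t choices for the length of each
   arm, and the second moment is at most 1 + O(t^4/n) times the squared mean. As
   eps >= n^(-1/5), there is room for a t with n^(1/5) << t << n^(1/4). *)
Require Import Defs.
From mathcomp Require Import all_boot all_order all_algebra.
From mathcomp Require Import all_classical all_reals all_analysis.
From mathcomp Require Import ring lra zify.
Set Implicit Arguments.
Unset Strict Implicit.
Unset Printing Implicit Defensive.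
Import Order.TTheory GRing.Theory Num.Theory.
Import numFieldNormedType.Exports.
Local Open Scope ring_scope.

(** * Transfer operators of alternating walks *)

Section TupleSums.
Variables (R : nmodType) (V : finType).

Lemma big_tuple0 (f : seq V -> R) : \sum_(s : 0.-tuple V) f s = f [::].
Proof.
rewrite (eq_bigr (fun=> f [::])); last by move=> s _; rewrite (tuple0 s).
by rewrite sumr_const card_tuple expn0.
Qed.

Lemma big_tuple_cons l (f : seq V -> R) :
  \sum_(s : l.+1.-tuple V) f s = \sum_x \sum_(s : l.-tuple V) f (x :: s).
Proof.
rewrite pair_bigA /=.
rewrite (reindex (fun xs : V * l.-tuple V => cons_tuple xs.1 xs.2)) //=.
exists (fun s : l.+1.-tuple V => (thead s, behead_tuple s)).
  by case=> x s _ /=; congr pair; apply/val_inj.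
by move=> s _; rewrite [RHS]tuple_eta; apply/val_inj.
Qed.

Lemma big_tuple_cat k l (f : seq V -> R) :
  \sum_(s : (k + l).-tuple V) f s =
  \sum_(s1 : k.-tuple V) \sum_(s2 : l.-tuple V) f (s1 ++ s2).
Proof.
elim: k f => [|k IH] f.
  by rewrite (big_tuple0 (fun s1 => \sum_(s2 : l.-tuple V) f (s1 ++ s2))).
rewrite [LHS]big_tuple_cons.
rewrite (big_tuple_cons _ (fun s1 => \sum_(s2 : l.-tuple V) f (s1 ++ s2))).
by apply: eq_bigr => x _; exact: (IH (fun s => f (x :: s))).
Qed.

End TupleSums.

Section Transfer.
Variables (R : comPzRingType) (V : finType) (M : bool -> V -> V -> R).

(* Colors are booleans here, and alternate along a walk whose first step has color
   [c]. *)
Fixpoint walk_weight (c : bool) (u : V) (s : seq V) : R :=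
  if s is w :: s' then M c u w * walk_weight (~~ c) w s' else 1.

Fixpoint transfer (l : nat) (c : bool) (g : V -> R) (u : V) : R :=
  if l is l'.+1 then \sum_w M c u w * transfer l' (~~ c) g w else g u.

Lemma walk_weight_cat c u s1 s2 :
  walk_weight c u (s1 ++ s2) =
  walk_weight c u s1 * walk_weight (c (+) odd (size s1)) (last u s1) s2.
Proof.
elim: s1 c u => [|w s1 IH] c u /=; first by rewrite addbF mul1r.
by rewrite IH mulrA addNb addbN.
Qed.

Lemma walk_weight_rcons c u s w :
  walk_weight c u (rcons s w) =
  walk_weight c u s * M (c (+) odd (size s)) (last u s) w.
Proof. by rewrite -cats1 walk_weight_cat /= mulr1. Qed.

Lemma walk_weight_prod c u s :
  walk_weight c u s =
  \prod_(i < size s) M (c (+) odd i) (nth u (u :: s) i) (nth u (u :: s) i.+1).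
Proof.
elim: s c u => [|w s IH] c u; first by rewrite big_ord0.
rewrite big_ord_recl /= addbF IH; congr (_ * _).
apply: eq_bigr => i _; rewrite /= addNb addbN.
by congr (M _ _ _); apply: set_nth_default => //=; rewrite ltnS ltnW.
Qed.

Lemma eq_transfer l c (g h : V -> R) u : g =1 h -> transfer l c g u = transfer l c h u.
Proof.
move=> gh; elim: l c u => [|l IH] c u //=.
by apply: eq_bigr => w _; rewrite IH.
Qed.

Lemma sum_walk_weight l c (g : V -> R) u :
  \sum_(s : l.-tuple V) walk_weight c u s * g (last u s) = transfer l c g u.
Proof.
elim: l c u => [|l IH] c u.
  by rewrite (big_tuple0 (fun s => walk_weight c u s * g (last u s))) /= mul1r.
rewrite (big_tuple_cons _ (fun s => walk_weight c u s * g (last u s))) /=.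
apply: eq_bigr => w _; rewrite -IH mulr_sumr.
by apply: eq_bigr => s _; rewrite mulrA.
Qed.

Lemma transferSr l c (g : V -> R) u :
  transfer l.+1 c g u =
  transfer l c (fun w => \sum_y M (c (+) odd l) w y * g y) u.
Proof.
elim: l c u => [|l IH] c u; first by rewrite /= addbF.
rewrite [LHS]/=; apply: eq_bigr => w _.
have -> : \sum_w0 M (~~ c) w w0 * transfer l (~~ ~~ c) g w0
        = transfer l.+1 (~~ c) g w by [].
rewrite IH; congr (_ * _); apply: eq_transfer => v.
by apply: eq_bigr => y _; rewrite /= addNb addbN.
Qed.

(** Transposing a product of symmetric matrices reverses its factors, so the reversed product begins
    with the color of the last step, [c (+) ~~ odd l]. *)
Lemma transfer_adjoint (Msym : forall c u w, M c u w = M c w u) l c (g h : V -> R) :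
  \sum_u h u * transfer l c g u =
  \sum_u transfer l (c (+) ~~ odd l) h u * g u.
Proof.
elim: l c h => [|l IH] c h //.
transitivity (\sum_w (\sum_u M c w u * h u) * transfer l (~~ c) g w).
  transitivity (\sum_u \sum_w M c w u * h u * transfer l (~~ c) g w).
    apply: eq_bigr => u _ /=; rewrite mulr_sumr; apply: eq_bigr => w _.
    by rewrite mulrA [h u * _]mulrC Msym.
  rewrite exchange_big; apply: eq_bigr => w _.
  by rewrite mulr_suml.
rewrite IH; apply: eq_bigr => u _.
rewrite transferSr; congr (_ * _).
rewrite oddS negbK addNb addbN negbK; apply: eq_transfer => w.
by rewrite -addbA addbb addbF.
Qed.

End Transfer.

(** * Weighted closed walks relative to a snake *)

Section Overlap.
Variables (R : realFieldType) (V : finType) (adj : bool -> V -> V -> bool).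
Variables (z : V) (A : {set V}) (k : nat).

(* No alternating walk inside the snake with fewer than [l] steps, started at [u]
   with color [c], visits the center [z]. *)
Fixpoint avoids (l : nat) (c : bool) (u : V) : Prop :=
  if l is l'.+1 then u != z /\ forall w, adj c u w -> avoids l' (~~ c) w
  else True.

(** These hypotheses abstract a snake with center [z] and vertices in [A]; they are verified below
    for [step_adj] of a figure eight. *)
Hypothesis adj_sym : forall c u w, adj c u w = adj c w u.
Hypothesis adj_fun : forall c u w w', u != z -> adj c u w -> adj c u w' -> w = w'.
Hypothesis adj_center : forall c, (#|adj c z| <= 2)%N.
Hypothesis adj_support : forall c u w, adj c u w -> u \in A.
Hypothesis card_support : (#|A| <= 2 * k.+1)%N.
Hypothesis avoids_center :
  forall l c w, (l <= k)%N -> adj c z w -> avoids l (~~ c) w.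

Lemma sum_adj_le c u (f : V -> R) (B : R) :
  0 <= B -> (forall w, adj c u w -> f w <= B) ->
  \sum_(w | adj c u w) f w <= (1 + (u == z)%:R) * B.
Proof.
move=> B0 fB; apply: le_trans (ler_sum _ fB) _.
rewrite sumr_const -[leLHS]mulr_natl ler_wpM2r //.
have [->|uz] := eqVneq u z; first by rewrite (ler_nat _ _ 2) adj_center.
rewrite addr0 (ler_nat _ _ 1).
case: (pickP (adj c u)) => [w /= uw|no].
  rewrite -(card1 w); apply: subset_leq_card; apply/fintype.subsetP => w'.
  by rewrite !inE => uw'; apply/eqP; exact: adj_fun uw' uw.
by rewrite (eq_card0 no).
Qed.

(** * Recurrences along the steps inside the snake *)

Section Unroll.
Variables (f : nat -> bool -> V -> R) (kappa : nat -> R) (L : nat).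
Hypothesis L_le : (L <= k.+1)%N.
Hypothesis kappa_ge0 : forall l, (l < L)%N -> 0 <= kappa l.
Hypothesis f0_le : forall c u, f 0 c u <= 1.
Hypothesis fS_le : forall l c u, (l < L)%N ->
  f l.+1 c u <= kappa l + \sum_(w | adj c u w) f l (~~ c) w.

Let B l := 1 + \sum_(j < l) kappa j.

Let B_ge1 l : (l <= L)%N -> 1 <= B l.
Proof.
move=> lL; rewrite lerDl sumr_ge0 // => i _.
by rewrite kappa_ge0 // (leq_trans (ltn_ord i)).
Qed.

Let B_S l : B l.+1 = B l + kappa l.
Proof. by rewrite /B big_ord_recr addrA. Qed.

(** Away from the center a walk in the snake has at most one continuation, so the terms [kappa] add
    up without branching. *)
Let unroll_avoids l c u : (l <= L)%N -> avoids l c u -> f l c u <= B l.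
Proof.
elim: l c u => [|l IH] c u lL /=.
  by move=> _; apply: le_trans (f0_le _ _) (B_ge1 _).
case=> uz au; apply: le_trans (fS_le _ _ lL) _.
rewrite B_S addrC lerD2r.
have Bl0 : 0 <= B l by apply: le_trans ler01 (B_ge1 (ltnW lL)).
have := sum_adj_le (c := c) (u := u) (f := f l (~~ c)) Bl0.
rewrite (negbTE uz) addr0 mul1r; apply => w uw.
by apply: IH; [exact: ltnW|exact: au].
Qed.

(* A walk in the snake of length at most k+1 meets the center at most once
   before its last step, whence at most 2 such walks from a given vertex. *)
Lemma unroll l c u : (l <= L)%N -> f l c u <= 2 * (1 + \sum_(j < l) kappa j).
Proof.
rewrite -/(B l).
elim: l c u => [|l IH] c u lL.
  apply: le_trans (f0_le _ _) _; have := B_ge1 lL; lra.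
have Bl1 := B_ge1 (ltnW lL); have kl0 := kappa_ge0 lL.
apply: le_trans (fS_le _ _ lL) _; rewrite B_S.
have [uz|uz] := eqVneq u z.
  subst u; have := sum_adj_le (c := c) (u := z) (f := f l (~~ c)) (B := B l).
  rewrite eqxx /= => H.
  have -> : 2 * (B l + kappa l) = kappa l + ((1 + 1%:R) * B l + kappa l) by ring.
  rewrite lerD2l; apply: le_trans (H _ _) _; [lra| |lra].
  move=> w zw; apply: unroll_avoids; first exact: ltnW.
  by apply: avoids_center => //; rewrite -ltnS (leq_trans lL).
have := sum_adj_le (c := c) (u := u) (f := f l (~~ c)) (B := 2 * B l).
rewrite (negbTE uz) addr0 mul1r => H.
have : \sum_(w | adj c u w) f l (~~ c) w <= 2 * B l.
  by apply: H; [lra | move=> w _; apply: IH; exact: ltnW].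
lra.
Qed.

End Unroll.

Variables (q : R) (n : nat).
Hypothesis n_def : #|V| = n.
Hypothesis q_gt0 : 0 < q.
Local Notation rho := (q * n%:R).
Hypothesis rho_ge1 : 1 <= rho.

(* Dominates the conditional probability of a colored edge given the snake. *)
Definition weight c u w : R := q + (adj c u w)%:R.
Local Notation T := (transfer weight).
Local Notation t := (k.+1%:R : R).
Let one : V -> R := fun=> 1.

Lemma weight_sym c u w : weight c u w = weight c w u.
Proof. by rewrite /weight adj_sym. Qed.

Lemma weight_ge0 c u w : 0 <= weight c u w.
Proof. by rewrite addr_ge0 ?ler0n // ltW. Qed.

Lemma walk_weight_ge0 c u s : 0 <= walk_weight weight c u s.
Proof.
by elim: s c u => [|w s IH] c u //=; rewrite mulr_ge0 ?weight_ge0.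
Qed.

Lemma transferS l c g u :
  T l.+1 c g u =
  q * (\sum_w T l (~~ c) g w) + \sum_(w | adj c u w) T l (~~ c) g w.
Proof.
rewrite [LHS]/= [in X in _ + X]big_mkcond mulr_sumr -big_split /=.
apply: eq_bigr => w _; rewrite mulrDl; congr (_ + _).
by case: adj; rewrite ?mul1r ?mul0r.
Qed.

Let n_gt0 : 0 < n%:R :> R.
Proof.
have := rho_ge1; case: n => [|m _]; last by rewrite ltr0n.
by rewrite mulr0; lra.
Qed.

(** Relative cost of the snake per step, for the total weight of walks: at most [4 * t] oriented
    steps of the snake, each followed by weight at most [2 * t * (rho * K) ^+ l], compete with the
    main term [n * rho * (rho * K) ^+ l]. *)
Definition growth : R := 1 + 8 * t ^+ 2 / n%:R.
Local Notation K := growth.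

Lemma growth_ge1 : 1 <= K.
Proof. by rewrite lerDl divr_ge0 ?ler0n // mulr_ge0 // exprn_ge0 // ler0n. Qed.

Let rho0 : 0 <= rho. Proof. exact: le_trans ler01 rho_ge1. Qed.
Let K0 : 0 <= K. Proof. exact: le_trans ler01 growth_ge1. Qed.

Lemma sum_total_adj_le c (f : V -> R) (B : R) : 0 <= B ->
  (forall w, f w <= B) -> \sum_u \sum_(w | adj c u w) f w <= 4 * t * B.
Proof.
move=> B0 fB.
rewrite (bigID (mem A)) /= [X in _ + X]big1 ?addr0; last first.
  by move=> u uA; apply: big1 => w uw; rewrite (adj_support uw) in uA.
apply: (@le_trans _ _ (\sum_(u in A) 2 * B)).
  apply: ler_sum => u _; apply: le_trans (sum_adj_le B0 _) _ => //.
  by rewrite ler_wpM2r //; case: eqP => _ /=; lra.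
rewrite sumr_const -[leLHS]mulr_natl mulrA ler_wpM2r //.
have : (#|A|%:R : R) <= 2 * t by rewrite -natrM ler_nat.
lra.
Qed.

Lemma geom_sum_le (x : R) l : 1 <= x ->
  1 + \sum_(j < l) x ^+ j.+1 <= l.+1%:R * x ^+ l.
Proof.
move=> x1; elim: l => [|l IH]; first by rewrite big_ord0 expr0; lra.
rewrite big_ord_recr /= addrA -[in leRHS]natr1 mulrDl mul1r lerD2r.
apply: le_trans IH _; rewrite ler_wpM2l ?ler0n // exprS ler_peMl //.
by rewrite exprn_ge0 // (le_trans ler01).
Qed.

Let rhoK1 : 1 <= rho * K.
Proof. exact: mulr_ege1 rho_ge1 growth_ge1. Qed.

Let rhoK0 : 0 <= rho * K. Proof. exact: mulr_ge0. Qed.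

Let one_recurrence l c u (L : nat)
  (HS : forall j c', (j < L)%N -> \sum_u T j c' one u <= n%:R * (rho * K) ^+ j) :
  (l < L)%N ->
  T l.+1 c one u <= (rho * K) ^+ l.+1 + \sum_(w | adj c u w) T l (~~ c) one w.
Proof.
move=> lL; rewrite transferS lerD2r.
apply: (@le_trans _ _ (q * (n%:R * (rho * K) ^+ l))).
  by rewrite ler_wpM2l ?HS // ltW.
rewrite mulrA exprS ler_wpM2r ?exprn_ge0 // ler_peMr //.
exact: growth_ge1.
Qed.

(** A step of weight [q] leads to any vertex, hence contributes [q] times a total; with these
    contributions as [kappa], [unroll] turns bounds on totals into a pointwise bound. *)
Let transfer_one_of_total L c u
  (HS : forall j c', (j < L)%N -> \sum_u T j c' one u <= n%:R * (rho * K) ^+ j) :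
  (L <= k.+1)%N -> T L c one u <= 2 * L.+1%:R * (rho * K) ^+ L.
Proof.
move=> Lk.
have := @unroll (fun l c u => T l c one u) (fun l => (rho * K) ^+ l.+1) L Lk.
move=> /(_ _ _ _ L c u (leqnn L)) H.
apply: (le_trans (H _ _ _)) => //.
- by move=> l _; rewrite exprn_ge0.
- by move=> l c' u' lL; exact: one_recurrence lL.
- by rewrite -[leRHS]mulrA ler_wpM2l // geom_sum_le.
Qed.

(** Totals at lengths below [l] bound the values at length [l]; these values and the total at length
    [l] bound the total at length [l.+1]. *)
Lemma transfer_total l c : (l <= k.+1)%N ->
  \sum_u T l c one u <= n%:R * (rho * K) ^+ l.
Proof.
elim/ltn_ind: l c => -[|l] IH c lk.
  by rewrite /= sumr_const n_def expr0 mulr1.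
have HS j c' : (j < l)%N -> \sum_u T j c' one u <= n%:R * (rho * K) ^+ j.
  by move=> jl; apply: IH; [exact: ltnW|lia].
have Tl c' u : T l c' one u <= 2 * t * (rho * K) ^+ l.
  apply: le_trans (transfer_one_of_total _ _ HS (ltnW lk)) _.
  by rewrite ler_wpM2r ?exprn_ge0 // ler_wpM2l // ler_nat.
have B0 : 0 <= 2 * t * (rho * K) ^+ l.
  by rewrite ?mulr_ge0 ?exprn_ge0 ?ler0n.
under eq_bigr => u _ do rewrite transferS.
rewrite big_split /= sumr_const n_def -[X in X + _ <= _]mulr_natl.
apply: (@le_trans _ _ (n%:R * (q * (n%:R * (rho * K) ^+ l))
                       + 4 * t * (2 * t * (rho * K) ^+ l))).
  apply: lerD; last by apply: sum_total_adj_le.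
  by rewrite ler_wpM2l ?ler0n // ler_wpM2l ?(ltW q_gt0) // IH // ltnW.
set X := (rho * K) ^+ l; have X0 : 0 <= X by rewrite exprn_ge0.
have -> : n%:R * (q * (n%:R * X)) + 4 * t * (2 * t * X)
     = (n%:R * rho + 8 * t ^+ 2) * X by ring.
rewrite [_ ^+ l.+1]exprS -/X [leRHS]mulrA ler_wpM2r //.
have -> : n%:R * (rho * K) = n%:R * rho + rho * (8 * t ^+ 2).
  by rewrite /K; field; rewrite gt_eqF.
by rewrite lerD2l ler_peMl // mulr_ge0 // exprn_ge0 // ler0n.
Qed.

Lemma transfer_one_le l c u : (l <= k.+1)%N ->
  T l c one u <= 2 * l.+1%:R * (rho * K) ^+ l.
Proof.
move=> lk; apply: transfer_one_of_total => // j c' jl.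
by apply: transfer_total; lia.
Qed.

(** * Closed walks, according to the position of their base point *)

Hypothesis k_even : ~~ odd k.
Hypothesis k_gt1 : (1 < k)%N.

Definition closed_weight c x : R :=
  \sum_(s : k.-tuple V | uniq (x :: s)) walk_weight weight c x (rcons s x).

(* [n * Q ^+ 2] is, up to the power of [K], the expected number
   [n ^ (2 * k + 1) * q ^ (2 * k + 2)] of snakes. *)
Let Q := q * rho ^+ k * K ^+ k.+1.

Let Q_ge0 : 0 <= Q.
Proof. by rewrite !mulr_ge0 ?exprn_ge0 // ltW. Qed.

Let q_rhoK_le : q * (rho * K) ^+ k <= Q.
Proof.
rewrite /Q exprMn mulrA ler_wpM2l ?mulr_ge0 ?exprn_ge0 ?(ltW q_gt0) //.
by rewrite ler_weXn2l // growth_ge1.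
Qed.

Let delta (x : V) : V -> R := fun u => (u == x)%:R.

Lemma sum_mul_delta (f : V -> R) x : \sum_u f u * delta x u = f x.
Proof.
rewrite (bigD1 x) //= /delta eqxx mulr1 big1 ?addr0 // => u /negbTE ->.
by rewrite mulr0.
Qed.

Let weight_closed c x (s : k.-tuple V) :
  walk_weight weight c x (rcons s x) =
  walk_weight weight c x s * weight c (last x s) x.
Proof. by rewrite walk_weight_rcons size_tuple (negbTE k_even) addbF. Qed.

Let closed_weight_le_all c x :
  closed_weight c x <=
  \sum_(s : k.-tuple V) walk_weight weight c x s * weight c (last x s) x.
Proof.
rewrite [leRHS](bigID (fun s : k.-tuple V => uniq (x :: s))) /=.
rewrite -[leLHS]addr0 lerD //.
  rewrite le_eqVlt; apply/orP; left; apply/eqP.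
  by apply: eq_bigr => s _; exact: weight_closed.
by apply: sumr_ge0 => s _; rewrite mulr_ge0 ?walk_weight_ge0 ?weight_ge0.
Qed.

(** Reversal: by symmetry of the weights, walks from anywhere to [x] are walks from [x] to
    anywhere. *)
Lemma transfer_delta_total l c x :
  \sum_u T l c (delta x) u = T l (c (+) ~~ odd l) one x.
Proof.
rewrite -(sum_mul_delta (T l (c (+) ~~ odd l) one)) -transfer_adjoint.
  by apply: eq_bigr => u _; rewrite mul1r.
exact: weight_sym.
Qed.

(** The 2 accounts for closed walks entirely inside the snake. Any other walk has a first step of
    weight [q], after which it continues from an arbitrary vertex to [x]; reversal bounds this by
    [2 * t * Q] for each of the [t] positions of that step. *)
Lemma closed_weight_le c x : closed_weight c x <= 2 + 4 * t ^+ 2 * Q.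
Proof.
apply: le_trans (closed_weight_le_all c x) _.
rewrite (sum_walk_weight weight k c (fun w => weight c w x)).
have -> : transfer weight k c (fun w => weight c w x) x = T k.+1 c (delta x) x.
  rewrite transferSr (negbTE k_even) addbF; apply: eq_transfer => w.
  by rewrite (sum_mul_delta (weight c w)).
pose kap := 2 * t * Q.
have kap0 : 0 <= kap by apply: mulr_ge0 => //; rewrite mulr_ge0 ?ler0n.
have := @unroll (fun l c u => T l c (delta x) u) (fun=> kap) k.+1 (leqnn _).
move=> /(_ _ _ _ k.+1 c x (leqnn _)) H.
apply: (le_trans (H _ _ _)) => //.
- by move=> c' u; rewrite /= /delta; case: eqP => _ /=; lra.
- move=> l c' u lk; rewrite transferS lerD2r transfer_delta_total.
  apply: (@le_trans _ _ (q * (2 * t * (rho * K) ^+ k))).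
    rewrite ler_wpM2l ?(ltW q_gt0) //.
    apply: le_trans (transfer_one_le _ _ (ltnW lk)) _.
    apply: ler_pM; rewrite ?mulr_ge0 ?exprn_ge0 ?ler0n //.
      by rewrite ler_wpM2l // ler_nat.
    by rewrite ler_weXn2l // -ltnS.
  by rewrite mulrCA /kap ler_wpM2l // mulr_ge0 ?ler0n.
- rewrite sumr_const card_ord -[kap *+ _]mulr_natl /kap.
  by rewrite le_eqVlt; apply/orP; left; apply/eqP; ring.
Qed.

Let k_pred : k = k.-1.+1.
Proof. by rewrite prednK // ltnW. Qed.

(** No step of the snake touches [x], so the first and last steps both have weight [q], with a total
    over [k.-1] steps in between. This gives the main term of the second moment, whence the leading
    constant 1. *)
Lemma closed_weight_outside c x : x \notin A -> closed_weight c x <= Q.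
Proof.
move=> xA; apply: le_trans (closed_weight_le_all c x) _.
have weightx w : weight c w x = q.
  rewrite /weight adj_sym; case: (boolP (adj c x w)) => [/adj_support|_].
    by rewrite (negbTE xA).
  by rewrite addr0.
under eq_bigr => s _ do rewrite weightx -[walk_weight _ _ _ _]mulr1.
rewrite -mulr_suml (sum_walk_weight weight k c (fun=> 1)) mulrC.
have -> : transfer weight k c (fun=> 1) x = q * \sum_u T k.-1 (~~ c) one u.
  rewrite k_pred transferS [X in _ + X]big1 ?addr0 // => w /adj_support.
  by rewrite (negbTE xA).
apply: le_trans q_rhoK_le; rewrite ler_wpM2l ?(ltW q_gt0) //.
apply: (@le_trans _ _ (q * (n%:R * (rho * K) ^+ k.-1))).
  by rewrite ler_wpM2l ?(ltW q_gt0) // transfer_total // leqW ?leq_pred.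
rewrite mulrA [in leRHS]k_pred [leRHS]exprS ler_wpM2r ?exprn_ge0 // ler_peMr //.
exact: growth_ge1.
Qed.

(* Away from the center a vertex has at most one edge of each color in the snake,
   so the first and last steps of a simple odd cycle are not both in it. *)
Lemma closed_weight_noncenter c x : x != z -> closed_weight c x <= 4 * t * Q.
Proof.
move=> xz.
(* One of the two steps at [x] has weight [q]. Dropping it leaves a walk of [k] steps that starts at
   [x] ([E1]) or ends at [x] ([E2]); by reversal both sums equal [T k c one x]. *)
apply: (@le_trans _ _ (q * T k c one x + q * T k c one x)); last first.
  have := ler_wpM2l (ltW q_gt0) (transfer_one_le c x (leqnSn k)).
  rewrite mulrCA => /le_trans/(_ (ler_wpM2l _ q_rhoK_le)) H.
  have := H _; rewrite mulr_ge0 ?ler0n // => /(_ isT); lra.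
have E1 : T k c one x = \sum_(s : k.-tuple V) walk_weight weight c x s.
  by rewrite -sum_walk_weight; apply: eq_bigr => s _; exact: mulr1.
have E2 : T k c one x = \sum_(s : k.-tuple V)
    walk_weight weight (~~ c) (head x s) (rcons (behead s) x).
  have -> : T k c one x = \sum_u T k (~~ c) (delta x) u.
    by rewrite transfer_delta_total (negbTE k_even) addbT negbK.
  pose f s := walk_weight weight (~~ c) (head x s) (rcons (behead s) x).
  rewrite [RHS](_ : _ = \sum_(s : k.-tuple V) f s) //.
  rewrite k_pred (big_tuple_cons _ f) /f /=.
  apply: eq_bigr => u _.
  have -> : \sum_w weight (~~ c) u w * T k.-1 (~~ ~~ c) (delta x) w
      = T k.-1.+1 (~~ c) (delta x) u by [].
  rewrite transferSr -sum_walk_weight; apply: eq_bigr => s _.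
  by rewrite sum_mul_delta walk_weight_rcons size_tuple.
rewrite {1}E1 E2 !mulr_sumr -big_split /= /closed_weight big_mkcond /=.
apply: ler_sum => s _; case: ifP => [/andP[xs us]|_]; last first.
  by rewrite addr_ge0 // mulr_ge0 ?walk_weight_ge0 // ltW.
have ss := size_tuple s.
case: (tval s) ss xs us => [|u s']; first by rewrite k_pred.
rewrite /= => ss; rewrite inE negb_or => /andP[xu xs'] /andP[us' _].
rewrite walk_weight_rcons.
have -> : ~~ c (+) odd (size s') = c.
  by move: k_even; rewrite -ss /= negbK => ->; rewrite addbT negbK.
have W0 := walk_weight_ge0 (~~ c) u s'.
move: (walk_weight _ _ _ _) W0 => W W0.
have uvl : last u s' != u.
  case: s' {xs'} ss us' => [|y s'] /= ss us'.
    by move: k_gt1; rewrite -ss.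
  by apply: contra us' => /eqP <-; exact: mem_last.
have : ~~ (adj c x u && adj c (last u s') x).
  apply: contra uvl => /andP[xu']; rewrite adj_sym => xl.
  by apply/eqP; exact: (adj_fun xz xl xu').
have q2 : 0 <= q * W * q by rewrite !mulr_ge0 // ltW.
have qW : 0 <= q * W by rewrite mulr_ge0 // ltW.
rewrite /weight; case: (adj c x u); case: (adj c _ x) => //= _; lra.
Qed.

(** The three terms come from all vertices, the at most [2 * t] vertices of [A], and the center. *)
Lemma sum_closed_weight_le :
  \sum_x closed_weight false x * closed_weight true x <=
  n%:R * Q ^+ 2 + 2 * t * (4 * t * Q) ^+ 2 + (2 + 4 * t ^+ 2 * Q) ^+ 2.
Proof.
have tQ0 : 0 <= 4 * t * Q by rewrite mulr_ge0 // mulr_ge0 ?ler0n.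
have cw0 c x : 0 <= closed_weight c x.
  by apply: sumr_ge0 => s _; exact: walk_weight_ge0.
pose b x : R := Q ^+ 2 + (if x \in A then (4 * t * Q) ^+ 2 else 0)
               + (if x == z then (2 + 4 * t ^+ 2 * Q) ^+ 2 else 0).
apply: (@le_trans _ _ (\sum_x b x)).
  apply: ler_sum => x _; rewrite /b.
  have sq0 := sqr_ge0 Q; have sq1 := sqr_ge0 (4 * t * Q).
  have sq2 := sqr_ge0 (2 + 4 * t ^+ 2 * Q).
  have [xz|xz] := eqVneq x z.
    apply: (@le_trans _ _ ((2 + 4 * t ^+ 2 * Q) ^+ 2)).
      by rewrite expr2 ler_pM ?closed_weight_le.
    by rewrite lerDr addr_ge0 //; case: ifP.
  rewrite addr0; case: (boolP (x \in A)) => xA.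
    apply: (@le_trans _ _ ((4 * t * Q) ^+ 2)); last by rewrite lerDr.
    by rewrite expr2 ler_pM ?closed_weight_noncenter.
  by rewrite addr0 expr2 ler_pM ?closed_weight_outside.
rewrite !big_split /= sumr_const n_def -!big_mkcond /= big_pred1_eq sumr_const.
rewrite -[Q ^+ 2 *+ _]mulr_natl -[_ ^+ 2 *+ _]mulr_natl lerD2r lerD2l.
by rewrite ler_wpM2r ?sqr_ge0 // -natrM ler_nat.
Qed.

End Overlap.

(** * Snakes *)

Section FigureEight.
Variables (V : finType) (k : nat).
Local Notation L := (k.+1.*2).

Definition central i : bool := [|| i == 0, i == k.+1 | i == L]%N.

(* A closed walk of length [L] through the center at times 0, k + 1 and L, with all
   other vertices distinct. Step [i] has color [odd i]; as [k] is even, the colors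
   still alternate when the walk goes through the center at time k + 1. *)
Definition figure_eight (a : nat -> V) : Prop :=
  (forall i, central i -> a i = a 0%N) /\
  (forall i j, (i <= L)%N -> (j <= L)%N -> a i = a j ->
     i = j \/ (central i && central j)).

Definition step_adj (a : nat -> V) (c : bool) (u w : V) : bool :=
  [exists i : 'I_L, (odd i == c) &&
     ((u == a i) && (w == a i.+1) || (w == a i) && (u == a i.+1))].

Lemma step_adjP a c u w :
  reflect (exists2 i, (i < L)%N & odd i = c /\
     ((u = a i /\ w = a i.+1) \/ (w = a i /\ u = a i.+1)))
    (step_adj a c u w).
Proof.
apply: (iffP existsP) => [[i /andP[/eqP ci H]]|[i iL [ci H]]].
  exists i => //; split=> //.
  by case/orP: H => /andP[/eqP-> /eqP->]; [left|right].
exists (Ordinal iL); rewrite /= ci eqxx /=.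
by case: H => -[-> ->]; rewrite !eqxx ?orbT.
Qed.

Lemma step_adj_sym a c u w : step_adj a c u w = step_adj a c w u.
Proof. by apply: eq_existsb => i; rewrite orbC. Qed.

Variable a : nat -> V.
Hypothesis a8 : figure_eight a.
Hypothesis k_even : ~~ odd k.
Hypothesis k_gt1 : (1 < k)%N.
Let a_central := a8.1.
Let a_inj := a8.2.

(** A noncentral vertex is visited once, and the steps leaving and entering it have colors [odd i]
    and [~~ odd i]. *)
Lemma step_adj_noncentral i c w : (i <= L)%N -> ~~ central i ->
  step_adj a c (a i) w -> w = a (if odd i == c then i.+1 else i.-1).
Proof.
move=> iL ci /step_adjP[j jL [<- [[] | []]]].
  move=> /(a_inj iL (ltnW jL))[<- ->|]; first by rewrite eqxx.
  by rewrite (negbTE ci).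
move=> -> /(a_inj iL jL)[->|]; first by rewrite /=; case: odd.
by rewrite (negbTE ci).
Qed.

Lemma step_adj_center c w : step_adj a c (a 0%N) w ->
  exists i, [/\ (i < L)%N, odd i = c &
    central i /\ w = a i.+1 \/ central i.+1 /\ w = a i].
Proof.
move=> /step_adjP[i iL [ci H]]; exists i; split=> //.
have c0 : central 0 by [].
case: H => [[/a_inj H ->]|[-> /a_inj H]]; [left|right]; split=> //.
  by case: H => [||<-|/andP[]//] //; exact: ltnW.
by case: H => [||//|/andP[]//].
Qed.

(** The color [odd i] at time [i] forces a walk to follow [a] forwards; the other color forces it
    backwards, as in [avoids_backward]. *)
Lemma avoids_forward l i : (i + l <= L)%N ->
  (forall j, (i <= j < i + l)%N -> ~~ central j) ->
  avoids (step_adj a) (a 0%N) l (odd i) (a i).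
Proof.
elim: l i => [//|l IH] i iL ci /=.
have cii : ~~ central i by apply: ci; lia.
split.
  apply/eqP => /a_inj[||ai|/andP[h]]; [lia|lia| |by rewrite (negbTE cii) in h].
  by move: cii; rewrite ai.
move=> w /(step_adj_noncentral _ cii); rewrite eqxx => ->; last lia.
by apply: (IH i.+1) => [|j jl]; [lia|apply: ci; lia].
Qed.

Lemma avoids_backward l i : (l <= i)%N -> (i <= L)%N ->
  (forall j, (i - l < j <= i)%N -> ~~ central j) ->
  avoids (step_adj a) (a 0%N) l (~~ odd i) (a i).
Proof.
elim: l i => [//|l IH] i li iL ci /=.
have cii : ~~ central i by apply: ci; lia.
split.
  apply/eqP => /a_inj[||ai|/andP[h]]; [lia|lia| |by rewrite (negbTE cii) in h].
  by move: cii; rewrite ai.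
move=> w /(step_adj_noncentral iL cii).
rewrite (_ : odd i == ~~ odd i = false) => [->|]; last by case: odd.
case: i li iL ci cii => // i li iL ci cii; rewrite /= negbK.
by apply: (IH i) => [||j jl]; [lia|lia|apply: ci; lia].
Qed.

Lemma avoids_from_center l c w : (l <= k)%N ->
  step_adj a c (a 0%N) w -> avoids (step_adj a) (a 0%N) l (~~ c) w.
Proof.
move=> lk /step_adj_center[i [iL <- [[ci ->]|[ci ->]]]].
  apply: (@avoids_forward l i.+1).
    by move: ci iL; rewrite /central; lia.
  by move=> j; move: ci iL; rewrite /central; lia.
apply: avoids_backward; [|lia|].
  by move: ci iL; rewrite /central; lia.
by move=> j; move: ci iL; rewrite /central; lia.
Qed.

Lemma card_step_adj_center c : (#|step_adj a c (a 0%N)| <= 2)%N.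
Proof.
(* At the center, color [false] belongs to steps [0] and [k], the ends of the first cycle, and color
   [true] to steps [k.+1] and [L.-1], the ends of the second. *)
pose i1 := if c then k.+2 else 1%N; pose i2 := if c then L.-1 else k.
apply: (@leq_trans #|[set a i1; a i2]|); last by rewrite cards2; case: eqP.
apply: subset_leq_card; apply/fintype.subsetP => w; rewrite unfold_in => /step_adj_center.
case=> i [iL ci [] [cen ->]]; rewrite !inE.
  suff -> : i.+1 = i1 by rewrite eqxx.
  by move: ci cen; rewrite /i1 /central; case: (c); lia.
suff -> : i = i2 by rewrite eqxx orbT.
by move: ci cen; rewrite /i2 /central; case: (c); lia.
Qed.

Lemma step_adj_fun c u w w' : u != a 0%N ->
  step_adj a c u w -> step_adj a c u w' -> w = w'.
Proof.
move=> u0 uw; have /step_adjP[i iL [_ ui]] := uw.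
have [j jL uj] : exists2 j, (j <= L)%N & u = a j.
  by case: ui => -[]; [exists i => //; exact: ltnW|exists i.+1].
move: uw; rewrite uj in u0 *.
have cj : ~~ central j by apply: contra u0 => /a_central ->.
by move=> /(step_adj_noncentral jL cj) -> /(step_adj_noncentral jL cj) ->.
Qed.

Lemma step_adj_support c u w :
  step_adj a c u w -> u \in [set a i | i : 'I_L].
Proof.
case/step_adjP => i iL [_ [[-> _]|[_ ->]]]; apply/imsetP.
  by exists (Ordinal iL).
have [iL'|iL'] := ltnP i.+1 L; first by exists (Ordinal iL').
(* Time [L] is outside ['I_L], but its vertex is the center, already indexed by 0. *)
have L0 : (0 < L)%N by [].
exists (Ordinal L0) => //=; apply: a_central.
by rewrite /central; lia.
Qed.

End FigureEight.

Section Snakes.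
Variables (V : finType) (k : nat).
Local Notation L := (k.+1.*2).

Local Notation snake := (V * k.-tuple V * k.-tuple V)%type.

(* [(x, s1, s2)] stands for the closed walk x, s1, x, s2, x. *)
Definition simple_snake (B : snake) : bool := uniq (B.1.1 :: B.1.2 ++ B.2).

Definition snake_walk (B : snake) (i : nat) : V :=
  nth B.1.1 (B.1.1 :: rcons B.1.2 B.1.1 ++ rcons B.2 B.1.1) i.

(** The list on the right has no second copy of the center, so times after [k.+1] shift by one;
    injectivity of the walk then reduces to [nth_uniq]. *)
Lemma snake_walk_nth B i : (i <= L)%N ->
  snake_walk B i = nth B.1.1 (B.1.1 :: B.1.2 ++ B.2)
    (if central k i then 0%N else if (i <= k)%N then i else i.-1).
Proof.
case: B => -[x s1] s2 iL; rewrite /snake_walk /= /central.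
have s1k := size_tuple s1; have s2k := size_tuple s2.
case: i iL => [|i] iL //=; rewrite nth_cat size_rcons s1k !nth_rcons s1k s2k.
have [ik|ki|ik] := ltngtP i k.
- rewrite ltnS ltnW // ifF /=; last lia.
  by rewrite nth_cat s1k ik.
- rewrite ltnNge ki /=.
  have [iL'|iL'] := ltnP (i - k.+1) k.
    rewrite ifF; last lia.
    case: i iL ki iL' => // i iL ki iL' /=; rewrite nth_cat s1k ifF; last lia.
    by rewrite subSS.
  by rewrite (_ : _ || _ = true); [case: eqP|lia].
- by rewrite ik ltnSn eqxx.
Qed.

Lemma simple_snake_figure_eight B : simple_snake B -> figure_eight k (snake_walk B).
Proof.
move=> uB; split=> [i ci|i j iL jL].
  have iL : (i <= L)%N by move: ci; rewrite /central; lia.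
  by rewrite snake_walk_nth // ci.
rewrite !snake_walk_nth // => /eqP; rewrite nth_uniq //.
- move=> /eqP; rewrite /central; repeat case: ifP => ?; lia.
- rewrite /= size_cat !size_tuple /central; case: ifP => ?; [lia|case: ifP => ?; lia].
- rewrite /= size_cat !size_tuple /central; case: ifP => ?; [lia|case: ifP => ?; lia].
Qed.

Lemma card_simple_snake : #|simple_snake| = #|V| ^_ (k + k).+1.
Proof.
have := card_uniq_tuples (k + k).+1 (@predT V); rewrite cardT => <-.
pose f (s : seq V) : nat := uniq s.
transitivity (\sum_(s : (k + k).+1.-tuple V) f s); last first.
  rewrite -sum1dep_card [RHS]big_mkcond; apply: eq_bigr => s _.
  by rewrite all_predT /f; case: uniq.
rewrite (big_tuple_cons _ f) -sum1_card.
under [RHS]eq_bigr => x _ do rewrite (big_tuple_cat _ _ (fun s => f (x :: s))).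
rewrite pair_bigA pair_bigA big_mkcond; apply: eq_bigr => -[[x s1] s2] _ /=.
by rewrite unfold_in /simple_snake /f /=; case: (_ && _).
Qed.

Lemma snake_weight (R : comPzRingType) (M : bool -> V -> V -> R) B : ~~ odd k ->
  \prod_(i < L) M (odd i) (snake_walk B i) (snake_walk B i.+1) =
  walk_weight M false B.1.1 (rcons B.1.2 B.1.1) *
  walk_weight M true B.1.1 (rcons B.2 B.1.1).
Proof.
case: B => -[x s1] s2 k_even /=.
(* The first cycle has odd length [k.+1], so the alternation reaches the second cycle with color
   [true]. *)
have -> : walk_weight M true x (rcons s2 x) =
  walk_weight M (false (+) odd (size (rcons s1 x))) (last x (rcons s1 x)) (rcons s2 x).
  by rewrite last_rcons size_rcons size_tuple /= k_even.
rewrite -walk_weight_cat walk_weight_prod.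
have -> : size (rcons s1 x ++ rcons s2 x) = L.
  by rewrite size_cat !size_rcons !size_tuple addnn.
by [].
Qed.

Variables (R : realFieldType) (q : R) (n : nat).
Hypothesis n_def : #|V| = n.
Hypothesis q_gt0 : 0 < q.
Hypothesis rho_ge1 : 1 <= q * n%:R.
Hypothesis k_even : ~~ odd k.
Hypothesis k_gt1 : (1 < k)%N.

(** The weights are nonnegative, so the sum may be enlarged by forgetting that the two cycles are
    disjoint; at each center it then factors into two closed walk sums. *)
Lemma overlap_sum_le a (t := k.+1%:R : R)
    (Q := q * (q * n%:R) ^+ k * (1 + 8 * t ^+ 2 / n%:R) ^+ k.+1) :
  figure_eight k a ->
  \sum_(B | simple_snake B)
    \prod_(i < L) weight (step_adj k a) q (odd i)
       (snake_walk B i) (snake_walk B i.+1) <=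
  n%:R * Q ^+ 2 + 2 * t * (4 * t * Q) ^+ 2 + (2 + 4 * t ^+ 2 * Q) ^+ 2.
Proof.
move=> a8.
apply: (@le_trans _ _ (\sum_x closed_weight (step_adj k a) k q false x *
   closed_weight (step_adj k a) k q true x)); last first.
  apply: (@sum_closed_weight_le _ _ _ (a 0%N) [set a i | i : 'I_L]) => //.
  - exact: step_adj_sym.
  - exact: step_adj_fun.
  - exact: card_step_adj_center.
  - exact: step_adj_support.
  - by apply: leq_trans (leq_imset_card _ _) _; rewrite cardT size_enum_ord mul2n.
  - exact: avoids_from_center.
under eq_bigr => B _ do rewrite snake_weight //.
under [leRHS]eq_bigr => x _ do rewrite /closed_weight mulr_suml big_mkcond.
pose W c x (s : k.-tuple V) := walk_weight (weight (step_adj k a) q) c x (rcons s x).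
pose F (x : V) (s1 s2 : k.-tuple V) : R :=
  if uniq (x :: s1) then W false x s1 * (if uniq (x :: s2) then W true x s2 else 0) else 0.
have W0 c x s : 0 <= W c x s by exact: walk_weight_ge0.
have F0 x s1 s2 : 0 <= F x s1 s2.
  by rewrite /F; do 2?case: ifP => _; rewrite ?mulr0 // mulr_ge0.
rewrite [leRHS](_ : _ = \sum_(B : snake) F B.1.1 B.1.2 B.2); last first.
  rewrite -(pair_bigA _ (fun (xs : V * k.-tuple V) s2 => F xs.1 xs.2 s2)) /=.
  rewrite -(pair_bigA _ (fun x s1 => \sum_s2 F x s1 s2)) /=.
  apply: eq_bigr => x _; apply: eq_bigr => s1 _; rewrite /F /=.
  case: ifP => _; last by rewrite big1.
  by rewrite -mulr_sumr -big_mkcond.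
rewrite big_mkcond; apply: ler_sum => -[[x s1] s2] _.
case: ifP => [|_]; last exact: F0.
rewrite /simple_snake cons_uniq cat_uniq => /and4P[/= xs us1 _ us2].
rewrite mem_cat negb_or in xs; case/andP: xs => xs1 xs2.
by rewrite /F /= xs1 us1 xs2 us2.
Qed.

End Snakes.

(** * Presence of snakes in the random graph *)

Section Present.
Variables (V : finType) (k : nat).
Local Notation L := (k.+1.*2).
Local Notation vpair := (vpair V).

Definition walk_edge (a : nat -> V) (i : nat) : {set V} := [set a i; a i.+1].

(** Stating presence pair by pair makes its probability a product over pairs. *)
Definition allows (a : nat -> V) (e : vpair) (s : option color) : bool :=
  [forall i : 'I_L, (val e == walk_edge a i) ==> (s == Some (color_of_bool (odd i)))].

Definition present (a : nat -> V) (G : colored_graph V) : bool :=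
  [forall e, allows a e (G e)].

Section Walk.
Variable a : nat -> V.
Hypothesis a8 : figure_eight k a.
Hypothesis k_gt1 : (1 < k)%N.
Let a_inj := a8.2.

Lemma figure_eight_step i : (i < L)%N -> a i != a i.+1.
Proof.
move=> iL; apply/eqP => /(a_inj (ltnW iL) iL)[|/andP[]]; first lia.
by rewrite /central; lia.
Qed.

Lemma walk_edge_pair i : (i < L)%N -> exists e : vpair, val e = walk_edge a i.
Proof.
move=> iL; suff c2 : #|walk_edge a i| == 2%N.
  by exists (exist (fun e : {set V} => #|e| == 2%N) _ c2).
by rewrite cards2 figure_eight_step.
Qed.

Lemma walk_edge_inj i j : (i < L)%N -> (j < L)%N ->
  walk_edge a i = walk_edge a j -> i = j.
Proof.
move=> iL jL /setP E.
have := E (a i); have := E (a i.+1); rewrite !inE !eqxx orbT /=.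
have H x y : (x <= L)%N -> (y <= L)%N -> a x == a y -> x = y \/ central k x && central k y.
  by move=> xL yL /eqP; exact: a_inj.
move=> /esym/orP[] /H H1 /esym/orP[] /H H2.
all: have {H1} := H1 iL; have {H2} := H2 (ltnW iL); rewrite /central; lia.
Qed.

Lemma walk_edgeP (e : vpair) :
  (exists2 i : 'I_L, val e = walk_edge a i &
     forall j : 'I_L, (val e == walk_edge a j) = (j == i)) \/
  (forall i : 'I_L, (val e == walk_edge a i) = false).
Proof.
case: (pickP (fun i : 'I_L => val e == walk_edge a i)) => [i /eqP ei|no]; last by right.
left; exists i => // j; apply/eqP/eqP => [ej|->//].
by apply/val_inj/(walk_edge_inj (ltn_ord j) (ltn_ord i)); rewrite -ei -ej.
Qed.

Lemma prod_walk_edge (R : comPzRingType) (g : nat -> R) :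
  \prod_(e : vpair) \prod_(i < L | val e == walk_edge a i) g i = \prod_(i < L) g i.
Proof.
rewrite (exchange_big_dep predT) //=; apply: eq_bigr => i _.
have [ei Ei] := walk_edge_pair (ltn_ord i).
by rewrite (big_pred1 ei) // => e /=; rewrite -Ei.
Qed.

(** A vertex with the color of the step leaving it forces the opposite color, that of the next step,
    on its successor. A blue center is thus forced to be red by the first cycle, and a red center to
    be blue by the second. *)
Lemma present_not_colorable G : ~~ odd k -> present a G -> ~~ adaptably_2_colorable G.
Proof.
move=> k_even /forallP aG; apply/existsP => -[sigma /forallP sG].
pose col i := color_of_bool (odd i).
have step i : (i < L)%N -> sigma (a i) = col i -> sigma (a i.+1) = col i.+1.
  move=> iL si; have [e Ee] := walk_edge_pair iL.
  have /forallP/(_ (Ordinal iL)) := aG e; rewrite Ee eqxx /= => Ge.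
  have /forallP/(_ (a i))/forallP/(_ (a i.+1))/forallP/(_ (col i)) := sG e.
  rewrite Ee Ge eqxx /= si eqxx /= /col /=.
  by case: (sigma (a i.+1)); case: odd.
have steps i j : (i + j <= L)%N -> sigma (a i) = col i -> sigma (a (i + j)%N) = col (i + j)%N.
  move=> ijL si; elim: j ijL => [|j IH] ijL; first by rewrite addn0.
  by rewrite addnS; apply: step; [lia|apply: IH; lia].
have aE i : central k i -> a i = a 0%N by exact: a8.1.
have a1 : a k.+1 = a 0%N by apply: aE; rewrite /central; lia.
have a2 : a L = a 0%N by apply: aE; rewrite /central; lia.
have colk : col k.+1 = red by rewrite /col /= k_even.
have colL : col L = blue by rewrite /col odd_double.
case E : (sigma (a 0%N)).
- have := steps k.+1 k.+1; rewrite addnn a1 a2 colk colL E leqnn.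
  by move=> /(_ isT erefl).
- have : sigma (a (0 + k.+1)%N) = col (0 + k.+1)%N by apply: steps => //; lia.
  by rewrite add0n a1 E colk.
Qed.

End Walk.
End Present.

Section Probability.
Variables (R : realType) (n : nat) (p : R).
Local Notation vpair := (vpair 'I_n).
Local Notation q := (p / 2).

Lemma pair_mass_Some a : pair_mass p (Some a) = q.
Proof. by rewrite /pair_mass card_color. Qed.

Lemma gnp2_prob_forall (P : vpair -> pred (option color)) :
  gnp2_prob p (fun G : colored_graph 'I_n => [forall e, P e (G e)]) =
  \prod_e \sum_(s | P e s) pair_mass p s.
Proof.
rewrite (bigA_distr_big_dep _ (fun _ => pair_mass p)).
by apply: eq_bigl => G; apply/forallP/familyP.
Qed.

Variables (k : nat).
Hypothesis k_gt1 : (1 < k)%N.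
Local Notation L := (k.+1.*2).

Lemma present_prob (a : nat -> 'I_n) : figure_eight k a ->
  gnp2_prob p (present k a) = q ^+ L.
Proof.
move=> a8; rewrite gnp2_prob_forall -[L in RHS]card_ord -prodr_const.
rewrite -(prod_walk_edge a8 k_gt1 (fun=> q)); apply: eq_bigr => e _.
have [[i ei Hi]|no] := walk_edgeP a8 k_gt1 e.
  rewrite (big_pred1 i) // (big_pred1 (Some (color_of_bool (odd i)))).
    exact: pair_mass_Some.
  move=> s; apply/forallP/eqP => [/(_ i)|-> j]; first by rewrite ei eqxx => /eqP.
  by rewrite Hi; apply/implyP => /eqP->.
rewrite [RHS]big_pred0 // -[RHS](pair_mass_sum1 p); apply: eq_bigl => s.
by apply/forallP => i; rewrite no.
Qed.

(** Compared pair by pair: a pair used by only one walk costs [q]; one used by both costs [q] if the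
    colors agree, where the weight is at least 1, and has probability 0 if they conflict. *)
Lemma present2_prob_le (a b : nat -> 'I_n) : 0 <= p <= 1 ->
  figure_eight k a -> figure_eight k b ->
  gnp2_prob p (fun G => present k a G && present k b G) <=
  q ^+ L * \prod_(i < L) weight (step_adj k a) q (odd i) (b i) (b i.+1).
Proof.
move=> p01 a8 b8.
have q0 : 0 <= q by case/andP: p01 => p0 _; rewrite divr_ge0.
pose P e s := allows k a e s && allows k b e s.
rewrite [leLHS](_ : _ = gnp2_prob p (fun G => [forall e, P e (G e)])); last first.
  apply: eq_bigl => G; rewrite /P; apply/andP/forallP => [[/forallP aG /forallP bG] e|H].
    by rewrite aG bG.
  by split; apply/forallP => e; case/andP: (H e).
rewrite gnp2_prob_forall -[L in _ ^+ L]card_ord -prodr_const.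
rewrite -(prod_walk_edge a8 k_gt1 (fun=> q)).
rewrite -(prod_walk_edge b8 k_gt1 (fun i => weight _ q (odd i) (b i) (b i.+1))).
rewrite -big_split /=; apply: ler_prod => e _.
have mass0 s : 0 <= pair_mass p s by exact: pair_mass_ge0.
apply/andP; split; first exact: sumr_ge0.
have sum_le_q c : (forall s, P e s -> s == Some c) ->
    \sum_(s | P e s) pair_mass p s <= q.
  move=> Ps; rewrite -(pair_mass_Some c) [leLHS]big_mkcond (bigD1 (Some c)) //.
  rewrite big1 => [|s sc]; first by rewrite [leLHS]addr0; case: ifP.
  by case: ifP => // /Ps; rewrite (negbTE sc).
have allowsE w (i : 'I_L) s :
    val e = walk_edge w i -> allows k w e s -> s == Some (color_of_bool (odd i)).
  by move=> ei /forallP/(_ i); rewrite ei eqxx.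
have [[i ei Hi]|noa] := walk_edgeP a8 k_gt1 e; last first.
  rewrite [X in X * _]big_pred0 // mul1r.
  have [[j ej Hj]|nob] := walk_edgeP b8 k_gt1 e; last first.
    rewrite [leRHS]big_pred0 // -(pair_mass_sum1 p) [leLHS]big_mkcond.
    by apply: ler_sum => s _; case: ifP.
  rewrite (big_pred1 j) //; apply: le_trans (sum_le_q (color_of_bool (odd j)) _) _.
    by move=> s /andP[_]; exact: allowsE.
  by rewrite lerDl.
rewrite [X in X * _](big_pred1 i) //.
have le_q : \sum_(s | P e s) pair_mass p s <= q.
  by apply: (sum_le_q (color_of_bool (odd i))) => s /andP[/(allowsE _ _ _ ei)].
have [[j ej Hj]|nob] := walk_edgeP b8 k_gt1 e; last by rewrite [X in _ * X]big_pred0 // mulr1.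
rewrite (big_pred1 j) //; have [ij|ij] := eqVneq (odd i) (odd j).
  apply: le_trans le_q _; rewrite ler_peMr // /weight.
  suff -> : step_adj k a (odd j) (b j) (b j.+1) by rewrite lerDr.
  apply/step_adjP; exists i => //; split=> //.
  have bj := figure_eight_step b8 k_gt1 (ltn_ord j).
  have /setP E : walk_edge a i = walk_edge b j by rewrite -ei.
  have := E (b j); have := E (b j.+1); rewrite !inE !eqxx orbT /=.
  case/orP=> /eqP E1; case/orP=> /eqP E2; auto;
    by rewrite E1 E2 eqxx in bj.
rewrite big_pred0; first by rewrite mulr_ge0 // addr_ge0.
move=> s; apply/negP => /andP[/(allowsE _ _ _ ei)/eqP->].
move=> /(allowsE _ _ _ ej)/eqP[]; move: ij; by do 2!case: odd.
Qed.
End Probability.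

(** * Second moment *)

Section Numeric.
Variable R : realFieldType.

Lemma ffact_ge (n m : nat) : (0 < n)%N ->
  n%:R ^+ m * (1 - m%:R ^+ 2 / n%:R) <= (n ^_ m)%:R :> R.
Proof.
move=> n0; have n0' : 0 < n%:R :> R by rewrite ltr0n.
elim: m => [|m IH]; first by rewrite expr0 expr0n mul0r subr0 mulr1.
rewrite ffactnSr; have [nm|mn] := ltnP n m.
  apply: le_trans (ler0n _ _); rewrite pmulr_rle0 ?exprn_gt0 // subr_le0.
  rewrite ler_pdivlMr // mul1r -natrX ler_nat.
  apply: leq_trans (ltnW nm) _; apply: leq_trans (leqnSn _) _.
  by rewrite -{1}(expn1 m.+1) leq_pexp2l.
rewrite natrM natrB //.
have nm0 : 0 <= n%:R - m%:R :> R by rewrite subr_ge0 ler_nat.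
apply: le_trans (ler_wpM2r nm0 IH).
have X0 : 0 <= n%:R ^+ m :> R by rewrite exprn_ge0 // ltW.
rewrite exprS [n%:R * _]mulrC -mulrA -[leRHS]mulrA ler_wpM2l //.
have m0 : 0 <= m%:R :> R by [].
rewrite -natr1; set N : R := n%:R; set a : R := m%:R.
have -> : N * (1 - (a + 1) ^+ 2 / N) = N - (a + 1) ^+ 2.
  by field; rewrite gt_eqF.
have -> : (1 - a ^+ 2 / N) * (N - a) = N - a - a ^+ 2 + a ^+ 3 / N.
  by field; rewrite gt_eqF.
have : 0 <= a ^+ 3 / N by rewrite divr_ge0 ?exprn_ge0 // ltW.
nra.
Qed.

Lemma bernoulli_ge (a : R) m : -1 <= a -> 1 + m%:R * a <= (1 + a) ^+ m.
Proof.
move=> a1; elim: m => [|m IH]; first by rewrite expr0 mul0r addr0.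
rewrite exprS; have a0 : 0 <= 1 + a by lra.
apply: le_trans (ler_wpM2l a0 IH); rewrite -natr1.
have : 0 <= m%:R :> R by [].
nra.
Qed.

(** An upper bound on a power from Bernoulli's lower bound for [1 - a], as
    [(1 + a) * (1 - a) <= 1]. *)
Lemma bernoulli_le (a : R) m : 0 <= a <= 1 -> (1 + a) ^+ m * (1 - m%:R * a) <= 1.
Proof.
move=> /andP[a0 a1].
have H : 1 - m%:R * a <= (1 - a) ^+ m.
  by rewrite -mulrN; apply: bernoulli_ge; lra.
have P0 : 0 <= (1 + a) ^+ m by rewrite exprn_ge0 //; lra.
apply: le_trans (ler_wpM2l P0 H) _; rewrite -exprMn exprn_ile1 //; nra.
Qed.

End Numeric.

Section SecondMoment.
Variables (R : realType) (n : nat) (p : R) (k : nat).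
Hypothesis p01 : 0 <= p <= 1.
Hypothesis k_even : ~~ odd k.
Hypothesis k_gt1 : (1 < k)%N.
Local Notation L := (k.+1.*2).
Local Notation snake := ('I_n * k.-tuple 'I_n * k.-tuple 'I_n)%type.
Local Notation q := (p / 2).
Let hit (B : snake) := present k (snake_walk B).
Let S (G : colored_graph 'I_n) : R := \sum_(B : snake | simple_snake B) (hit B G)%:R.
Let mu : R := (n ^_ (k + k).+1)%:R * q ^+ L.

Lemma gnp2_prob_indicator (A : pred (colored_graph 'I_n)) :
  gnp2_prob p A = \sum_G gnp2_mass p G * (A G)%:R.
Proof.
rewrite /gnp2_prob big_mkcond; apply: eq_bigr => G _.
by case: (A G); rewrite ?mulr1 ?mulr0.
Qed.

Let S_mean : \sum_G gnp2_mass p G * S G = mu.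
Proof.
under eq_bigr => G _ do rewrite mulr_sumr.
rewrite exchange_big /=.
rewrite (eq_bigr (fun=> q ^+ L)); last first.
  move=> B sB; rewrite -gnp2_prob_indicator.
  by apply: present_prob => //; exact: simple_snake_figure_eight.
by rewrite sumr_const card_simple_snake card_ord -[LHS]mulr_natl.
Qed.

Let S_square (Z : R) :
  (forall A : snake, simple_snake A -> \sum_(B : snake | simple_snake B)
     \prod_(i < L) weight (step_adj k (snake_walk A)) q (odd i)
        (snake_walk B i) (snake_walk B i.+1) <= Z) ->
  \sum_G gnp2_mass p G * S G ^+ 2 <= mu * Z.
Proof.
move=> HZ.
have q0 : 0 <= q by case/andP: p01 => p0 _; rewrite divr_ge0.
apply: (@le_trans _ _ (\sum_(A : snake | simple_snake A) \sum_(B : snake | simple_snake B)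
   gnp2_prob p (fun G => hit A G && hit B G))).
  under [leRHS]eq_bigr => A _ do under eq_bigr => B _ do rewrite gnp2_prob_indicator.
  under [leRHS]eq_bigr => A _ do rewrite exchange_big.
  rewrite [leRHS]exchange_big; apply: ler_sum => G _ /=.
  rewrite expr2 {1}/S mulr_suml mulr_sumr; apply: ler_sum => A _.
  rewrite mulr_sumr mulr_sumr; apply: ler_sum => B _.
  by rewrite -natrM mulnb.
apply: (@le_trans _ _ (\sum_(A : snake | simple_snake A) q ^+ L * Z)).
  apply: ler_sum => A sA; have A8 := simple_snake_figure_eight sA.
  apply: le_trans (ler_wpM2l (exprn_ge0 _ q0) (HZ A sA)); rewrite mulr_sumr.
  apply: ler_sum => B sB; apply: present2_prob_le => //.
  exact: simple_snake_figure_eight.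
by rewrite sumr_const card_simple_snake card_ord -[leLHS]mulr_natl mulrA.
Qed.

Lemma gnp2_prob_compl (A : pred (colored_graph 'I_n)) :
  gnp2_prob p A + gnp2_prob p (fun G => ~~ A G) = 1.
Proof.
by rewrite -(gnp2_prob_total n p) /gnp2_prob [RHS](bigID A).
Qed.

(** Chebyshev: [S] vanishes on colorable graphs, so their probability times [mu ^+ 2] is at most the
    variance, itself at most [mu * Z - mu ^+ 2]. *)
Lemma not_colorable_ge_second_moment (Z : R) : 0 < mu ->
  (forall A : snake, simple_snake A -> \sum_(B : snake | simple_snake B)
     \prod_(i < L) weight (step_adj k (snake_walk A)) q (odd i)
        (snake_walk B i) (snake_walk B i.+1) <= Z) ->
  2 - Z / mu <= gnp2_prob p (fun G : colored_graph 'I_n => ~~ adaptably_2_colorable G).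
Proof.
move=> mu0 /S_square HS.
have mass0 (G : colored_graph 'I_n) := gnp2_mass_ge0 G p01.
set P := gnp2_prob p _.
have PE : gnp2_prob p (@adaptably_2_colorable 'I_n) = 1 - P.
  by rewrite -(gnp2_prob_compl (@adaptably_2_colorable 'I_n)) addrK.
suff : (1 - P) * mu ^+ 2 <= mu * Z - mu ^+ 2.
  rewrite expr2 => H.
  have {}H : (1 - P) * mu <= Z - mu by rewrite -(ler_pM2l mu0); lra.
  have : 1 - P <= Z / mu - 1.
    by rewrite -(ler_pM2r mu0) [leRHS]mulrBl mul1r divfK // gt_eqF.
  lra.
rewrite -PE gnp2_prob_indicator mulr_suml.
apply: (@le_trans _ _ (\sum_G gnp2_mass p G * (S G - mu) ^+ 2)).
  apply: ler_sum => G _; rewrite -mulrA ler_wpM2l //.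
  case: (boolP (adaptably_2_colorable G)) => cG; last by rewrite mul0r sqr_ge0.
  rewrite mul1r (_ : S G = 0) ?sub0r ?sqrrN //.
  apply: big1 => B sB; case: (boolP (hit B G)) => // hB.
  have := present_not_colorable (simple_snake_figure_eight sB) k_gt1 k_even hB.
  by rewrite cG.
have -> : \sum_G gnp2_mass p G * (S G - mu) ^+ 2 =
    \sum_G gnp2_mass p G * S G ^+ 2 - 2 * mu * (\sum_G gnp2_mass p G * S G)
    + mu ^+ 2 * \sum_(G : colored_graph 'I_n) gnp2_mass p G.
  by rewrite !mulr_sumr -sumrB -big_split; apply: eq_bigr => G _ /=; ring.
have tot : \sum_(G : colored_graph 'I_n) gnp2_mass p G = 1.
  exact: gnp2_prob_total.
by rewrite S_mean tot mulr1; lra.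
Qed.

Lemma not_colorable_ge (t := k.+1%:R : R) (rho := q * n%:R) (y := t ^+ 4 / n%:R) :
  1 <= rho -> n%:R <= rho ^+ k.+1 -> y <= 100^-1 ->
  1 - 200 * y <= gnp2_prob p (fun G : colored_graph 'I_n => ~~ adaptably_2_colorable G).
Proof.
move=> rho1 nrho y100.
have q0 : 0 <= q by case/andP: p01 => p0 _; rewrite divr_ge0.
have n0 : 0 < n%:R :> R.
  by move: rho1; rewrite /rho; case: (n) => [|m _]; rewrite ?ltr0n // mulr0; lra.
have qgt0 : 0 < q.
  by rewrite lt_neqAle q0 andbT; apply/eqP => q00; move: rho1; rewrite /rho -q00 mul0r; lra.
have t1 : 1 <= t by rewrite /t ler1n.
have t0 : 0 <= t by lra.
pose a := 8 * t ^+ 2 / n%:R.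
pose K := (1 + a) ^+ k.+1.
pose Q0 := q * rho ^+ k.
pose Z := n%:R * (Q0 * K) ^+ 2 + 2 * t * (4 * t * (Q0 * K)) ^+ 2
          + (2 + 4 * t ^+ 2 * (Q0 * K)) ^+ 2.
have y0 : 0 <= y by rewrite divr_ge0 ?exprn_ge0 // ltW.
have y1 : y <= 1 by lra.
have t2_le : t ^+ 2 <= t ^+ 4 by rewrite ler_weXn2l.
have t3_le : t ^+ 3 <= t ^+ 4 by rewrite ler_weXn2l.
have yn : t ^+ 4 = y * n%:R by rewrite divfK // gt_eqF.
have t2y : t ^+ 2 / n%:R <= y by rewrite ler_wpM2r // invr_ge0 ltW.
have t3y : t ^+ 3 / n%:R <= y by rewrite ler_wpM2r // invr_ge0 ltW.
have t2y0 : 0 <= t ^+ 2 / n%:R by rewrite divr_ge0 ?exprn_ge0 // ltW.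
have a01 : 0 <= a <= 1 by rewrite /a -mulrA; apply/andP; split; lra.
have K1 : 1 <= K by rewrite exprn_ege1 // lerDl; case/andP: a01.
have KY : K * (1 - 8 * y) <= 1.
  apply: le_trans (bernoulli_le k.+1 a01).
  apply: ler_wpM2l; first exact: le_trans ler01 K1.
  suff : t * a <= 8 * y by rewrite /t; lra.
  by rewrite (_ : t * a = 8 * (t ^+ 3 / n%:R)); [lra|rewrite /a; ring].
(* This is where [n <= rho ^ t] enters, since [n * Q0 = rho ^ t]; it lets [4 * t ^+ 2 * Q] absorb
   the additive 2 at the center. *)
have Q01 : 1 <= Q0.
  rewrite -(ler_pM2l n0) mulr1; apply: le_trans nrho _.
  by rewrite /Q0 mulrA [_ * q]mulrC -exprS.
set D := n%:R * Q0 ^+ 2.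
have D0 : 0 < D by rewrite mulr_gt0 // exprn_gt0 //; lra.
have muD : D * (1 - 4 * y) <= mu.
  have -> : D = n%:R ^+ (k + k).+1 * q ^+ L.
    rewrite /D /Q0 (exprMn k q) [n%:R ^+ _.+1]exprS -addnn !exprD [q ^+ k.+1]exprS.
    by move: (q ^+ k) (n%:R ^+ k) => x z; ring.
  rewrite mulrAC ler_wpM2r ?exprn_ge0 //.
  apply: le_trans (ffact_ge _ _ _); last by rewrite -(ltr0n R).
  rewrite ler_wpM2l ?exprn_ge0 ?(ltW n0) // lerD2l lerN2.
  have kt : ((k + k).+1%:R : R) <= 2 * t.
    by rewrite /t -natrM ler_nat addnn mul2n doubleS leqnSn.
  have kt2 : ((k + k).+1%:R : R) ^+ 2 <= 4 * t ^+ 2.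
    have -> : 4 * t ^+ 2 = (2 * t) ^+ 2 by ring.
    by rewrite ler_pXn2r // nnegrE // mulr_ge0.
  have n0V : 0 <= (n%:R : R)^-1 by rewrite invr_ge0 ltW.
  have := ler_wpM2r n0V kt2; rewrite -mulrA; lra.
have mu0 : 0 < mu by apply: lt_le_trans muD; rewrite mulr_gt0 //; lra.
(* Here 68 is 32 from the vertices of the snake plus 36 from its center, using [t ^+ 4 = y * n]. *)
have ZD : Z <= D * (K ^+ 2 * (1 + 68 * y)).
  set Q := Q0 * K in @Z *.
  have Q1 : 1 <= Q by exact: mulr_ege1.
  have -> : D * (K ^+ 2 * (1 + 68 * y)) =
      n%:R * Q ^+ 2 + 32 * t ^+ 4 * Q ^+ 2 + (6 * t ^+ 2 * Q) ^+ 2.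
    rewrite (_ : (6 * t ^+ 2 * Q) ^+ 2 = 36 * t ^+ 4 * Q ^+ 2); last by ring.
    by rewrite yn /D /Q; ring.
  rewrite /Z; apply: lerD; first apply: lerD => //.
    have -> : 2 * t * (4 * t * Q) ^+ 2 = 32 * t ^+ 3 * Q ^+ 2 by ring.
    by rewrite ler_wpM2r ?sqr_ge0 // ler_wpM2l.
  have t2Q : 1 <= t ^+ 2 * Q by rewrite mulr_ege1 // exprn_ege1.
  rewrite ler_pXn2r // ?nnegrE; lra.
apply: le_trans (not_colorable_ge_second_moment mu0 (Z := Z) _); last first.
  move=> A sA; apply: overlap_sum_le => //; first exact: card_ord.
  exact: simple_snake_figure_eight.
suff : Z / mu <= 1 + 200 * y by lra.
rewrite ler_pdivrMr //; apply: le_trans ZD _.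
have : D * ((1 + 200 * y) * (1 - 4 * y)) <= (1 + 200 * y) * mu.
  by rewrite mulrCA ler_wpM2l //; lra.
apply: le_trans; rewrite ler_wpM2l ?(ltW D0) //.
(* To first order in [y] the right side gains [200 - 16 - 4 = 180], well above 68; [y <= 1/100]
   controls the higher orders. *)
have poly : 1 + 68 * y <= (1 - 8 * y) ^+ 2 * ((1 + 200 * y) * (1 - 4 * y)).
  nra.
apply: le_trans (ler_wpM2l (sqr_ge0 K) poly) _.
rewrite mulrA -exprMn ler_piMl //; first by rewrite mulr_ge0; lra.
rewrite exprn_ile1 // mulr_ge0 //; lra.
Qed.

End SecondMoment.

(** * Asymptotics *)

(** With [2 ^ j <= M < 2 ^ j.+1], it suffices that [45 * j.+1 <= 2 ^ j.+1 <= 2 * M], which holds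
    from [j = 8] on. *)
Lemma pow45_le_expn4 M : (256 <= M)%N -> (M ^ 45 <= 4 ^ M)%N.
Proof.
move=> M256; have M0 : (0 < M)%N by apply: leq_trans M256.
set j := trunc_log 2 M.
have /andP[jM Mj] := trunc_log_bounds (isT : (1 < 2)%N) M0.
have j8 : (8 <= j)%N by apply: trunc_log_max.
have H i : (8 <= i)%N -> (45 * i.+1 <= 2 ^ i.+1)%N.
  elim: i => // i IH; rewrite leq_eqVlt => /orP[/eqP<-//|i8].
  by have := IH i8; rewrite [(2 ^ i.+2)%N]expnS; lia.
apply: (@leq_trans ((2 ^ j.+1) ^ 45)); first by rewrite leq_exp2r // ltnW.
rewrite -expnM (_ : 4 = 2 ^ 2)%N // -expnM leq_exp2l //.
rewrite mulnC; apply: leq_trans (H j j8) _.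
by rewrite expnS leq_mul2l jM orbT.
Qed.

(* For n close to M^45, n^(1/5) is close to M^9, and t = 2 M^10 + 1 lies between
   n^(1/5) and n^(1/4). *)
Lemma pow45_between (n : nat) : (0 < n)%N ->
  exists2 M, (0 < M)%N & (M.-1 ^ 45 <= n < M ^ 45)%N.
Proof.
move=> n0.
have ex : exists M, (n < M ^ 45)%N.
  exists n.+1; rewrite -[X in (X < _)%N]expn1.
  by apply: (@leq_trans (n.+1 ^ 1)); rewrite // leq_pexp2l.
case: (ex_minnP ex) => -[|M]; first by rewrite exp0n.
move=> nM min; exists M.+1 => //; rewrite nM andbT /= leqNgt.
by apply/negP => /min; rewrite ltnn.
Qed.

Section Asymptotics.
Variables (R : realType).

Lemma powR_fifth_ge (n M : nat) : (0 < n)%N -> (n < M ^ 45)%N ->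
  (M%:R ^+ 9)^-1 <= (n%:R : R) `^ (- (1 / 5)).
Proof.
move=> n0 nM; have n0' : 0 < n%:R :> R by rewrite ltr0n.
rewrite powRN lef_pV2 ?posrE ?powR_gt0 //; last first.
  by rewrite exprn_gt0 // ltr0n; case: M nM => //; rewrite exp0n.
have -> : M%:R ^+ 9 = (M%:R ^+ 45 : R) `^ (1 / 5).
  rewrite -!powR_mulrn ?ler0n // -powRrM; congr (_ `^ _).
  by field.
apply: ge0_ler_powR; rewrite ?nnegrE ?exprn_ge0 ?ler0n //.
by rewrite -natrX ler_nat ltnW.
Qed.

(** By Bernoulli [(1 + e) ^ (M ^ 9) >= 2], so the power [2 * M ^ 10] is at least [4 ^ M]. *)
Lemma growth_ge (M : nat) (e : R) : (256 <= M)%N -> (M%:R ^+ 9)^-1 <= e ->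
  M%:R ^+ 45 <= (1 + e) ^+ (2 * M ^ 10).+1.
Proof.
move=> M256 eM; have M0 : (0 < M)%N by apply: leq_trans M256.
have M0' : 0 < M%:R :> R by rewrite ltr0n.
have e0 : 0 <= e by apply: le_trans eM; rewrite invr_ge0 exprn_ge0 // ltW.
apply: (@le_trans _ _ (4 ^+ M)); first by rewrite -!natrX ler_nat pow45_le_expn4.
apply: (@le_trans _ _ ((1 + e) ^+ (2 * M ^ 10))); last by rewrite ler_weXn2l //; lra.
have -> : (2 * M ^ 10 = M ^ 9 * 2 * M)%N by rewrite expnSr; lia.
rewrite exprM ler_pXn2r // ?nnegrE ?exprn_ge0 //; try lra.
rewrite exprM; have -> : 4 = 2 ^+ 2 :> R by ring.
rewrite ler_pXn2r // ?nnegrE ?exprn_ge0 //; try lra.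
apply: le_trans (bernoulli_ge _ _); last by lra.
rewrite natrX.
have : M%:R ^+ 9 * (M%:R ^+ 9)^-1 <= M%:R ^+ 9 * e.
  by rewrite ler_wpM2l // exprn_ge0 // ltW.
rewrite divff ?gt_eqF ?exprn_gt0 //; lra.
Qed.

(** From [M <= 2 * M.-1] follows [M ^ 45 <= 2 ^ 45 * n], while [t <= 3 * M ^ 10] gives
    [t ^ 4 * M <= 81 * M ^ 41]. *)
Lemma length_fourth_power_le (n M : nat) : (1 < M)%N -> (M.-1 ^ 45 <= n)%N ->
  (2 * M ^ 10).+1%:R ^+ 4 / n%:R <= 81 * 2 ^+ 45 / M%:R :> R.
Proof.
move=> M1 Mn.
have M1' : 1 <= M%:R :> R by rewrite ler1n ltnW.
have M0 : 0 < M%:R :> R by lra.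
have nM : M%:R ^+ 45 <= 2 ^+ 45 * n%:R :> R.
  rewrite -!natrX -natrM ler_nat; apply: leq_trans (_ : (2 ^ 45 * M.-1 ^ 45 <= _)%N).
    by rewrite -expnMn leq_exp2r //; lia.
  by rewrite leq_mul2l Mn orbT.
have n0 : 0 < n%:R :> R.
  by rewrite ltr0n; apply: leq_trans Mn; rewrite expn_gt0; lia.
rewrite ler_pdivrMr // mulrAC ler_pdivlMr //.
have H : (2 * M ^ 10).+1%:R <= 3 * M%:R ^+ 10 :> R.
  rewrite -natrX -natrM ler_nat.
  have : (0 < M ^ 10)%N by rewrite expn_gt0 ltnW.
  move: (M ^ 10)%N => X; lia.
have {}H : (2 * M ^ 10).+1%:R ^+ 4 <= (3 * M%:R ^+ 10) ^+ 4 :> R.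
  by rewrite ler_pXn2r // nnegrE ?ler0n // mulr_ge0 ?ler0n ?exprn_ge0 ?(ltW M0).
apply: (@le_trans _ _ (81 * M%:R ^+ 45)); last first.
  by move: nM; set X := 2 ^+ 45; lra.
apply: le_trans (ler_wpM2r (ltW M0) H) _.
rewrite exprMn -exprM -mulrA -exprSr (_ : 3 ^+ 4 = 81 :> R); last by ring.
by rewrite ler_wpM2l // ler_weXn2l.
Qed.

End Asymptotics.

Local Open Scope classical_set_scope.
Local Open Scope ring_scope.

Theorem theorem1p5 (R : realType) (lambda : nat -> R) (p : nat -> R)
  (lambda_gt0 : forall n : nat, 0 < lambda n)
  (lambda_infty : lambda n @[n --> \oo] --> +oo)
  (p_def : forall n : nat,
     p n = 2 * (1 + lambda n * n%:R `^ (- (1 / 5))) / n%:R)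
  (p_prob : \forall n \near \oo, 0 <= p n <= 1) :
  gnp2_prob (p n) (fun Gc : colored_graph 'I_n => ~~ adaptably_2_colorable Gc)
    @[n --> \oo] --> (1 : R).
Proof.
have lambda1 : \forall n \near \oo, 1 <= lambda n by exact: (cvgryPge _).1 lambda_infty 1.
apply/cvgrPdist_le => e e0.
(* As [y <= C / M], the threshold [C * (100 + 200 / e) <= M] yields both [y <= 1/100] and
   [200 * y <= e]. *)
pose C : R := 81 * 2 ^+ 45.
have C0 : 0 < C by rewrite mulr_gt0 // exprn_gt0.
have [N0 HN0] : exists N0 : nat, C * (100 + 200 / e) <= N0%:R.
  exists (Num.truncn (C * (100 + 200 / e))).+1; apply: ltW.
  exact: truncnS_gt.
pose N := maxn 256 N0.
near=> n.
have nN : (N ^ 45 <= n)%N by near: n; exact: nbhs_infty_ge.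
have n0 : (0 < n)%N.
  by apply: leq_trans nN; rewrite expn_gt0 leq_max.
have l1 : 1 <= lambda n by near: n.
have p01 : 0 <= p n <= 1 by near: n.
have [M M0 /andP[Mn nM]] := pow45_between n0.
have NM : (N < M)%N by rewrite -(ltn_exp2r _ _ (isT : (0 < 45)%N)) (leq_ltn_trans nN).
have M256 : (256 <= M)%N by exact: leq_trans (leq_maxl 256 N0) (ltnW NM).
have N0M : (N0 <= M)%N by exact: leq_trans (leq_maxr 256 N0) (ltnW NM).
have n0' : 0 < n%:R :> R by rewrite ltr0n.
have M0' : 0 < M%:R :> R by rewrite ltr0n.
pose eps := lambda n * n%:R `^ (- (1 / 5)).
have epsM : (M%:R ^+ 9)^-1 <= eps.
  apply: le_trans (powR_fifth_ge R n0 nM) _.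
  by rewrite /eps ler_peMl // powR_ge0.
have eps0 : 0 <= eps by apply: le_trans epsM; rewrite invr_ge0 exprn_ge0 // ltW.
have rhoE : p n / 2 * n%:R = 1 + eps.
  by rewrite p_def -/eps; field; rewrite gt_eqF.
have k_even : ~~ odd (2 * M ^ 10) by rewrite oddM.
have k_gt1 : (1 < 2 * M ^ 10)%N.
  by rewrite (@leq_trans (2 * 1)) // leq_mul2l expn_gt0 M0.
have := @not_colorable_ge R n _ _ p01 k_even k_gt1; cbv zeta.
rewrite rhoE; set y := _ / n%:R; set P := gnp2_prob _ _ => H.
have yC : y <= C / M%:R by apply: length_fourth_power_le => //; exact: leq_trans M256.
have CM : C * (100 + 200 / e) <= M%:R.
  by apply: le_trans HN0 _; rewrite ler_nat.
have Ce0 : 0 < C * (200 / e) by rewrite mulr_gt0 // divr_gt0.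
have y1 : y <= 100^-1.
  apply: le_trans yC _; rewrite ler_pdivrMr //; lra.
have y2 : 200 * y <= e.
  apply: (@le_trans _ _ (200 * (C / M%:R))); first by rewrite ler_wpM2l.
  rewrite mulrA ler_pdivrMr //.
  have -> : 200 * C = e * (C * (200 / e)) by field; rewrite gt_eqF.
  rewrite ler_wpM2l ?(ltW e0) //; lra.
have P1 : P <= 1.
  rewrite -(gnp2_prob_compl (p n) (@adaptably_2_colorable 'I_n)) lerDr.
  by apply: sumr_ge0 => G _; exact: gnp2_mass_ge0.
have P0 : 1 - 200 * y <= P.
  apply: H => //; first lra.
  apply: le_trans (growth_ge M256 epsM).
  by rewrite -natrX ler_nat ltnW.
rewrite ger0_norm; lra.
Unshelve. all: by end_near.
Qed.
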